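(* Let $L$ be a well-separated completely semidistributive lattice. For any set $A$ of completely join-irreducible elements of $L$, the following are equivalent. (1) $\bigvee A$ is a canonical join representation. (2) For all $i\neq j$ in $A$ one has $i\le\kappa(j)$.
   Context: $L$ is a complete lattice with least element $\hat 0$ and greatest element $\hat 1$; $\bigvee\emptyset=\hat0$, $\bigwedge\emptyset=\hat1$. An element $j$ is completely join-irreducible if $j=\bigvee X$ with $X\subseteq L$ implies $j\in X$; then $j$ covers a unique element $j_*$. $L$ is completely semidistributive if for all $x,w\in L$ and nonempty $Y\subseteq L$: if $x\vee y=w$ for all $y\in Y$ then $x\vee\bigwedge Y=w$, and if $x\wedge y=w$ for all $y\in Y$ then $x\wedge\bigvee Y=w$. In such a lattice, for each completely join-irreducible $j$ the maximum $\kappa(j)=\max\{y\in L\mid j\wedge y=j_*\}$ exists. $L$ is well-separated if for all $x\not\le y$ in $L$ there is a completely join-irreducible $j$ with $j\le x$ and $y\le\kappa(j)$. A join representation $x=\bigvee A$ ($A\subseteq L$) is canonical if $A$ is an antichain and, for every $B\subseteq L$ with $x=\bigvee B$, every $a\in A$ satisfies $a\le b$ for some $b\in B$. *)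

(* Defs.v *)
From mathcomp Require Import all_boot all_order.
From mathcomp Require Import boolp classical_sets.

Set Implicit Arguments.
Unset Strict Implicit.
Unset Printing Implicit Defensive.

Import Order.TTheory.
Local Open Scope order_scope.

Section CompleteLattices.
Context {d : Order.disp_t} {L : tbLatticeType d}.
Implicit Types (x y j k : L) (A B X Y : set L).

Definition complete_lattice :=
  forall A, (supremums A !=set0)%classic /\ (infimums A !=set0)%classic.

(* The default values of [supremum] and [infimum] give the conventions
   for the empty set; the fallback on sets without a supremum (or infimum) is
   never reached in a complete lattice (see [bigjoinP] and [bigmeetP]). *)
Definition bigjoin A : L := supremum \bot A.
Definition bigmeet A : L := infimum \top A.

Definition completely_join_irreducible j :=
  forall X, j = bigjoin X -> X j.

Definition covers x y := y < x /\ forall z, ~ (y < z /\ z < x).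

(* The element j_* covered by j. It is meaningful for completely
   join-irreducible j, where it exists and is unique (see [lower_coverP]). *)
Definition lower_cover j : L := xget \bot [set y | covers j y]%classic.

Definition is_max (Y : set L) k := Y k /\ forall y, Y y -> y <= k.

(* The maximum of the y such that j /\ y = j_*. It is meaningful for completely
   join-irreducible j in a completely semidistributive complete lattice, where
   the maximum exists (see [kappaP]). *)
Definition kappa j : L :=
  xget \bot [set k | is_max [set y | (j `&` y)%O = lower_cover j] k]%classic.

Definition completely_semidistributive :=
  forall x w Y, (Y !=set0)%classic ->
    ((forall y, Y y -> x `|` y = w) -> x `|` bigmeet Y = w) /\
    ((forall y, Y y -> x `&` y = w) -> x `&` bigjoin Y = w).

Definition well_separated :=
  forall x y, ~ (x <= y) ->
    exists j, [/\ completely_join_irreducible j, j <= x & y <= kappa j].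

Definition antichain A := forall a b, A a -> A b -> a <= b -> a = b.

Definition canonical_join_representation x A :=
  [/\ x = bigjoin A, antichain A &
      forall B, x = bigjoin B ->
        forall a, A a -> exists b, B b /\ a <= b].

Lemma bigjoinP A : complete_lattice -> supremums A (bigjoin A).
Proof.
move=> cL; rewrite /bigjoin /supremum; case: ifPn => [/eqP -> | _].
  by split=> [//|y _]; exact: le0x.
by have [[s sA] _] := cL A; exact: xgetPex (ex_intro _ s sA).
Qed.

Lemma bigmeetP A : complete_lattice -> infimums A (bigmeet A).
Proof.
move=> cL; rewrite /bigmeet /infimum; case: ifPn => [/eqP -> | _].
  by split=> [//|y _]; exact: lex1.
by have [_ [s sA]] := cL A; exact: xgetPex (ex_intro _ s sA).
Qed.

Lemma lower_coverP j : complete_lattice ->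
  completely_join_irreducible j ->
  forall y, covers j y <-> y = lower_cover j.
Proof.
move=> cL jirr; pose S := [set y | (y < j)%O]%classic.
have [ubS lubS] := bigjoinP S cL.
have ltSj : bigjoin S < j.
  rewrite lt_neqAle (lubS j) ?andbT; last by move=> y /ltW.
  by apply/eqP => e; have := jirr S (esym e); rewrite /S /= ltxx.
have covS : covers j (bigjoin S).
  by split=> // z [ltSz /ubS/(lt_le_trans ltSz)]; rewrite ltxx.
have uniqS y : covers j y -> y = bigjoin S.
  move=> [ltyj nbt]; apply/eqP; move: (ubS y ltyj); rewrite le_eqVlt.
  by case/orP=> // ltyS; case: (nbt (bigjoin S)).
have lcS : lower_cover j = bigjoin S.
  by apply: uniqS; exact: (xgetPex \bot (ex_intro _ _ covS)).
by move=> y; rewrite lcS; split=> [/uniqS|->].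
Qed.

Lemma kappaP j : complete_lattice -> completely_semidistributive ->
  completely_join_irreducible j ->
  is_max [set y | (j `&` y)%O = lower_cover j]%classic (kappa j).
Proof.
move=> cL sdL jirr; pose Y := [set y | (j `&` y)%O = lower_cover j]%classic.
suff YP : is_max Y (bigjoin Y) by exact: (xgetPex \bot (ex_intro _ _ YP)).
split; last by move=> y Yy; have [+ _] := bigjoinP Y cL; apply.
have [|_] := sdL j (lower_cover j) Y; last by apply.
have [ltj _] : covers j (lower_cover j) by apply/lower_coverP.
by exists (lower_cover j); exact: (meet_r (ltW ltj)).
Qed.

End CompleteLattices.

Arguments complete_lattice {d} L.
Arguments completely_semidistributive {d} L.
Arguments well_separated {d} L.

(* Main.v *)
(* For (1) => (2), replacing j by j_* in A gives an element y with j_* <= y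
   that is not above j, for otherwise canonicity would put j below another
   element of A; so y <= kappa j.
   For (2) => (1), let a be in A and m = kappa a; then \/ A <= a \/ m. If
   \/ A = \/ B, some b in B is not below m, and well-separation gives k <= b
   with m <= kappa k. Since k <= a \/ m, this forces kappa k = m, and
   semidistributivity of the joins m \/ a = m \/ k gives a <= k <= b. *)
Require Import Defs.
From mathcomp Require Import all_boot all_order.
From mathcomp Require Import boolp classical_sets.
Import Order.TTheory.
Local Open Scope order_scope.

Section Kappa.
Set Implicit Arguments.
Unset Strict Implicit.
Context {d : Order.disp_t} {L : tbLatticeType d}.
Context (cL : complete_lattice L).
Implicit Types (x y j k : L) (A B : set L).

Lemma bigjoin_ub A y : A y -> y <= bigjoin A.
Proof. by have [ub _] := bigjoinP A cL; exact: ub. Qed.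

Lemma bigjoin_le A y : (forall x, A x -> x <= y) -> bigjoin A <= y.
Proof. by have [_ lub] := bigjoinP A cL; exact: lub. Qed.

Lemma bigmeet_lb A y : A y -> bigmeet A <= y.
Proof. by have [lb _] := bigmeetP A cL; exact: lb. Qed.

Lemma lower_cover_lt j : completely_join_irreducible j -> lower_cover j < j.
Proof. by move=> jirr; have [] : covers j (lower_cover j) by apply/lower_coverP. Qed.

(** If [y] joined with [lower_cover j] were [j], irreducibility applied to this pair would make [j]
    one of the two. So the join is strictly below [j], and the covering relation collapses it to
    [lower_cover j]. *)
Lemma le_lower_cover j y :
  completely_join_irreducible j -> y < j -> y <= lower_cover j.
Proof.
move=> jirr yj; have [cj nb] : covers j (lower_cover j) by apply/lower_coverP.
have lej : y `|` lower_cover j <= j by rewrite leUx !ltW.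
have ltj : y `|` lower_cover j < j.
  rewrite lt_neqAle lej andbT; apply/eqP => e.
  have [] : [set y; lower_cover j]%classic j.
  - apply: jirr; apply/le_anti/andP; split.
      by rewrite -[leLHS]e leUx !bigjoin_ub //; [right|left].
    by apply: bigjoin_le => z [->|->]; exact: ltW.
  - by move=> ej; rewrite -ej ltxx in yj.
  - by move=> ej; rewrite -ej ltxx in cj.
have : lower_cover j <= y `|` lower_cover j by exact: leUr.
rewrite le_eqVlt => /orP[/eqP e|lt]; first by rewrite [leRHS]e leUl.
by case: (nb (y `|` lower_cover j)).
Qed.

Context (sdL : completely_semidistributive L).

Lemma meet_kappa j :
  completely_join_irreducible j -> j `&` kappa j = lower_cover j.
Proof. by move=> jirr; have [] := kappaP cL sdL jirr. Qed.

Lemma lower_cover_le_kappa j :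
  completely_join_irreducible j -> lower_cover j <= kappa j.
Proof. by move=> jirr; rewrite -meet_kappa // leIr. Qed.

Lemma not_le_kappa j : completely_join_irreducible j -> ~ (j <= kappa j).
Proof.
move=> jirr /meet_l e; have := lower_cover_lt jirr.
by rewrite -meet_kappa // e ltxx.
Qed.

(** The meet of [j] and [y] is strictly below [j], hence equal to [lower_cover j], so maximality of
    [kappa j] applies to [y]. *)
Lemma le_kappa j y : completely_join_irreducible j ->
  lower_cover j <= y -> ~ (j <= y) -> y <= kappa j.
Proof.
move=> jirr cy njy; have [_] := kappaP cL sdL jirr; apply => /=.
apply/le_anti; rewrite lexI cy (ltW (lower_cover_lt jirr)) !andbT.
apply: le_lower_cover => //; rewrite lt_neqAle leIl andbT.
by apply/eqP => /esym e; apply: njy; rewrite e leIr.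
Qed.

Lemma le_of_kappa_le a k :
    completely_join_irreducible a -> completely_join_irreducible k ->
  kappa a <= kappa k -> k <= a `|` kappa a -> a <= k.
Proof.
move=> airr kirr akk kle.
have nak : ~ (a <= kappa k).
  move=> ak; apply: (not_le_kappa kirr); apply: le_trans kle _.
  by rewrite leUx ak.
have lca := lower_cover_le_kappa airr.
(* [kappa k] is above [lower_cover a] but not above [a], so [le_kappa] bounds it by [kappa a]. *)
have ek : kappa k = kappa a.
  by apply/le_anti; rewrite akk le_kappa // (le_trans lca akk).
(* Otherwise this join is below [kappa a], which is [kappa k], and [k] would be below [kappa k]. *)
have aU : a <= kappa a `|` k.
  have [//|/negP na] := boolP (a <= kappa a `|` k).
  case: (not_le_kappa kirr); rewrite ek; apply: le_trans (leUr _ (kappa a)) _.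
  by apply: le_kappa na => //; exact: le_trans lca (leUl _ _).
have eU : kappa a `|` k = kappa a `|` a.
  by apply/le_anti; rewrite !leUx !leUl aU /= joinC kle.
pose Y := [set a; k]%classic.
have eY : kappa a `|` bigmeet Y = kappa a `|` a.
  have Y0 : (Y !=set0)%classic by exists a; left.
  by have [+ _] := @sdL (kappa a) (kappa a `|` a) Y Y0; apply=> y [->|->].
have Ya : bigmeet Y <= a by apply: bigmeet_lb; left.
have Yk : bigmeet Y <= k by apply: bigmeet_lb; right.
(* If the meet of [a] and [k] were strictly below [a], it would be below [lower_cover a], hence
   absorbed by [kappa a]; then [eY] would put [a] below [kappa a]. *)
move: Ya; rewrite le_eqVlt => /orP[/eqP e|lt]; first by rewrite -e.
case: (not_le_kappa airr); apply: le_trans (leUr _ (kappa a)) _.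
by rewrite -eY leUx lexx (le_trans (le_lower_cover airr lt) lca).
Qed.

End Kappa.

Theorem theorem3 (d : Order.disp_t) (L : tbLatticeType d)
    (L_complete : complete_lattice L)
    (L_semidistributive : completely_semidistributive L)
    (L_well_separated : well_separated L)
    (A : set L)
    (A_irreducible : forall a : L, A a -> completely_join_irreducible a) :
  canonical_join_representation (bigjoin A) A <->
  (forall i j : L, A i -> A j -> i <> j -> i <= kappa j).
Proof.
split=> [[_ antiA canA] i j Ai Aj neij|leA].
  have jirr := A_irreducible j Aj.
  pose B := [set y | (A y /\ y <> j) \/ y = lower_cover j]%classic.
  have Bi : B i by left.
  apply: le_trans (bigjoin_ub L_complete Bi) _.
  apply: le_kappa => //; first by apply: bigjoin_ub => //; right.
  move=> jB; have eB : bigjoin A = bigjoin B.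
    apply/le_anti/andP; split; apply: bigjoin_le => // y.
      by move=> Ay; have [->//|ny] := pselect (y = j); apply: bigjoin_ub; [|left].
    case=> [[Ay _]|->]; first exact: bigjoin_ub.
    by apply: le_trans (bigjoin_ub L_complete Aj); rewrite ltW ?lower_cover_lt.
  (* An element of [B] above [j] is either another element of [A], against the antichain property,
     or [lower_cover j], which is strictly below [j]. *)
  have [b [[[Ab nb]|->] jb]] := canA B eB j Aj.
    by apply: nb; rewrite (antiA j b).
  by have := lt_le_trans (lower_cover_lt L_complete jirr) jb; rewrite ltxx.
split=> // [i j Ai Aj ij|B eB a Aa].
  (* For distinct [i <= j], condition (2) with the roles exchanged gives [j <= kappa i], hence
     [i <= kappa i]. *)
  apply: contrapT => neij.
  apply: (not_le_kappa L_complete L_semidistributive (A_irreducible i Ai)).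
  by apply: le_trans ij (leA _ _ Aj Ai _) => /esym.
have airr := A_irreducible a Aa.
have [b [Bb nb]] : exists b, B b /\ ~ (b <= kappa a).
  apply: contrapT => nex.
  apply: (not_le_kappa L_complete L_semidistributive airr).
  apply: le_trans (bigjoin_ub L_complete Aa) _; rewrite eB.
  apply: bigjoin_le => // b Bb.
  by apply: contrapT => nb; apply: nex; exists b.
have [k [kirr kb akk]] := L_well_separated _ _ nb.
exists b; split=> //; apply: le_trans (kb); apply: le_of_kappa_le => //.
(* By (2) every element of [A] other than [a] is below [kappa a], so the join of [A], and with it
   [k], is below the join of [a] and [kappa a]. *)
apply: le_trans kb (le_trans (bigjoin_ub L_complete Bb) _); rewrite -eB.
apply: bigjoin_le => // y Ay.
have [->|ny] := pselect (y = a); first exact: leUl.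
exact: le_trans (leA _ _ Ay Aa ny) (leUr _ _).
Qed.
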